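(* Let $n\ge 1$, let $B=(b_{ij})$ be a real $n\times n$ matrix with $b_{ij}\ge 0$ for all $i,j$ and $b_{ii}=0$, let $c\in\mathbb{R}^n$ and $X\subseteq\{0,1\}^n$. Let $\overline{X}$ satisfy $X\subseteq\overline{X}\subseteq[0,1]^n$, and for $i=1,\dots,n$ let $v_i=\max\{\sum_{j\neq i}b_{ij}x_j : x\in\overline{X},\ x_i=0\}$ and $l_i=\min\{\sum_{j\neq i}b_{ij}x_j : x\in\overline{X},\ x_i=1\}$. For $\lambda\in\{0,1\}^n$ put $\overline{\alpha}_i^{(\lambda)}=\sum_{j\neq i}\lambda_jb_{ji}+\lambda_i(v_i-l_i)$ and $\overline{\beta}^{(\lambda)}=\sum_{i=1}^n\lambda_iv_i$. Consider (PL$_2$): minimize $\sum_{i=1}^n (y_i+c_ix_i)$ over $(x,y)\in X\times\mathbb{R}^n$ subject to $y_i\ge\sum_{j\neq i}b_{ij}x_j+v_ix_i-v_i$ and $y_i\ge l_ix_i$ ($i=1,\dots,n$); (PL$_2'$): minimize $\sum_{i=1}^n (t_i+(l_i+c_i)x_i)$ over $(x,t)\in X\times\mathbb{R}^n$ subject to $t_i\ge\sum_{j\neq i}b_{ij}x_j+(v_i-l_i)x_i-v_i$ and $t_i\ge 0$ ($i=1,\dots,n$); (DL$_2$): minimize $z+\sum_{i=1}^n(l_i+c_i)x_i$ over $(z,x)\in\mathbb{R}\times X$ subject to $z\ge\sum_{i=1}^n\overline{\alpha}_i^{(\lambda)}x_i-\overline{\beta}^{(\lambda)}$ for every $\lambda\in\{0,1\}^n$.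 Then (PL$_2$) (and likewise (PL$_2'$)) and (DL$_2$) are equivalent in the sense that for each optimal solution to one problem, there exists an optimal solution to the other problem having the same optimal objective value.
   Context: $\overline{X}$ is a relaxation of $X$; it is assumed that for each $i$ the sets $\{x\in\overline{X}: x_i=0\}$ and $\{x\in\overline{X}: x_i=1\}$ are nonempty and the extrema defining $v_i,l_i$ are attained. *)

(* Defs.v *)
From HB Require Import structures.
From mathcomp Require Import all_boot all_order all_algebra.
From mathcomp Require Import boolp classical_sets reals.

Set Implicit Arguments.
Unset Strict Implicit.
Unset Printing Implicit Defensive.

Import Order.TTheory GRing.Theory Num.Theory.

Local Open Scope classical_set_scope.
Local Open Scope ring_scope.

(* Points of R^n are row vectors x : 'rV[R]_n, with coordinates x 0 i. *)

Definition binary_cube (R : realType) (n : nat) : set 'rV[R]_n :=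
  [set x | forall i, x 0 i = 0 \/ x 0 i = 1].

Definition unit_cube (R : realType) (n : nat) : set 'rV[R]_n :=
  [set x | forall i, 0 <= x 0 i <= 1].

(* Attained extrema: in particular A is nonempty. *)
Definition is_max (R : realType) (A : set R) (m : R) : Prop :=
  A m /\ ubound A m.

Definition is_min (R : realType) (A : set R) (m : R) : Prop :=
  A m /\ lbound A m.

Definition offdiag_sum (R : realType) (n : nat) (b : 'M[R]_n) (i : 'I_n)
    (x : 'rV[R]_n) : R :=
  \sum_(j < n | j != i) b i j * x 0 j.

Definition offdiag_values (R : realType) (n : nat) (b : 'M[R]_n)
    (Xbar : set 'rV[R]_n) (i : 'I_n) (a : R) : set R :=
  [set offdiag_sum b i x | x in [set u | Xbar u /\ u 0 i = a]].

Record min_problem (R : realType) := MinProblem {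
  solution : Type;
  feasible : set solution;
  objective : solution -> R }.

Arguments feasible {R} m.
Arguments objective {R} m s.

Definition optimal (R : realType) (P : min_problem R) (s : solution P) : Prop :=
  feasible P s /\ forall s', feasible P s' -> objective P s <= objective P s'.

Definition equivalent_problems (R : realType) (P Q : min_problem R) : Prop :=
  (forall s : solution P, optimal s ->
     exists2 t : solution Q, optimal t & objective Q t = objective P s) /\
  (forall t : solution Q, optimal t ->
     exists2 s : solution P, optimal s & objective P s = objective Q t).

Definition PL2 (R : realType) (n : nat) (b : 'M[R]_n) (c : 'rV[R]_n)
    (X : set 'rV[R]_n) (v l : 'rV[R]_n) : min_problem R :=
  @MinProblem R ('rV[R]_n * 'rV[R]_n)%type
    [set s : 'rV[R]_n * 'rV[R]_n | let: (x, y) := s in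
       X x /\ forall i,
         y 0 i >= offdiag_sum b i x + v 0 i * x 0 i - v 0 i /\
         y 0 i >= l 0 i * x 0 i]
    (fun s : 'rV[R]_n * 'rV[R]_n => let: (x, y) := s in
       \sum_(i < n) (y 0 i + c 0 i * x 0 i)).

Definition PL2' (R : realType) (n : nat) (b : 'M[R]_n) (c : 'rV[R]_n)
    (X : set 'rV[R]_n) (v l : 'rV[R]_n) : min_problem R :=
  @MinProblem R ('rV[R]_n * 'rV[R]_n)%type
    [set s : 'rV[R]_n * 'rV[R]_n | let: (x, t) := s in
       X x /\ forall i,
         t 0 i >= offdiag_sum b i x + (v 0 i - l 0 i) * x 0 i - v 0 i /\
         t 0 i >= 0]
    (fun s : 'rV[R]_n * 'rV[R]_n => let: (x, t) := s in
       \sum_(i < n) (t 0 i + (l 0 i + c 0 i) * x 0 i)).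

(* The coefficient of x_i involves column i of b, i.e. b j i. *)
Definition alpha_bar (R : realType) (n : nat) (b : 'M[R]_n)
    (v l lam : 'rV[R]_n) (i : 'I_n) : R :=
  (\sum_(j < n | j != i) lam 0 j * b j i) + lam 0 i * (v 0 i - l 0 i).

Definition beta_bar (R : realType) (n : nat) (v lam : 'rV[R]_n) : R :=
  \sum_(i < n) lam 0 i * v 0 i.

Definition DL2 (R : realType) (n : nat) (b : 'M[R]_n) (c : 'rV[R]_n)
    (X : set 'rV[R]_n) (v l : 'rV[R]_n) : min_problem R :=
  @MinProblem R (R * 'rV[R]_n)%type
    [set s : R * 'rV[R]_n | let: (z, x) := s in
       X x /\ forall lam, binary_cube lam ->
         z >= (\sum_(i < n) alpha_bar b v l lam i * x 0 i) - beta_bar v lam]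
    (fun s : R * 'rV[R]_n => let: (z, x) := s in
       z + \sum_(i < n) (l 0 i + c 0 i) * x 0 i).

(* Main.v *)
(** Write [w_i] for [\sum_(j != i) b_ij x_j + (v_i - l_i) x_i - v_i]. Exchanging
    the order of summation, the [lambda]-constraint of (DL2) reads
    [z >= \sum_i lambda_i w_i]. The maximum over binary [lambda] of the
    right-hand side is [\sum_i max(0, w_i)], which is also the least value of
    [\sum_i t_i] in (PL2') for fixed [x]; and (PL2) is (PL2') after the
    substitution [y_i = t_i + l_i x_i]. *)

Require Import Defs.
From HB Require Import structures.
From mathcomp Require Import all_boot all_order all_algebra.
From mathcomp Require Import boolp classical_sets reals.
From mathcomp Require Import lra.

Set Implicit Arguments.
Unset Strict Implicit.
Unset Printing Implicit Defensive.

Import Order.TTheory GRing.Theory Num.Theory.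

Local Open Scope classical_set_scope.
Local Open Scope ring_scope.

(** [f] and [g] need not be inverse to each other: for [s] optimal and [t] feasible, the objectives
    at [f s], [s], [g t], [t] form a nondecreasing chain, so [f s] is optimal. *)
Lemma equivalent_of_maps (R : realType) (P Q : min_problem R)
    (f : solution P -> solution Q) (g : solution Q -> solution P) :
  (forall s, feasible P s ->
     feasible Q (f s) /\ objective Q (f s) <= objective P s) ->
  (forall t, feasible Q t ->
     feasible P (g t) /\ objective P (g t) <= objective Q t) ->
  equivalent_problems P Q.
Proof.
move=> fP gP; split.
- move=> s [/fP[fs_feas fs_le] s_min]; exists (f s).
    split=> // t /gP[gt_feas gt_le].
    exact: le_trans fs_le (le_trans (s_min _ gt_feas) gt_le).
  (* For the reverse inequality, [g (f s)] competes with the optimal [s]. *)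
  apply/le_anti; rewrite fs_le /=; have [gfs_feas gfs_le] := gP _ fs_feas.
  exact: le_trans (s_min _ gfs_feas) gfs_le.
- move=> t [/gP[gt_feas gt_le] t_min]; exists (g t).
    split=> // s /fP[fs_feas fs_le].
    exact: le_trans gt_le (le_trans (t_min _ fs_feas) fs_le).
  apply/le_anti; rewrite gt_le /=; have [fgt_feas fgt_le] := fP _ gt_feas.
  exact: le_trans (t_min _ fgt_feas) fgt_le.
Qed.

Lemma equivalent_problems_trans (R : realType) (P Q S : min_problem R) :
  equivalent_problems P Q -> equivalent_problems Q S ->
  equivalent_problems P S.
Proof.
move=> [PQ QP] [QS SQ]; split.
- by move=> s /PQ[t /QS[u u_opt uE] tE]; exists u; rewrite // uE.
- by move=> u /SQ[t /QP[s s_opt sE] tE]; exists s; rewrite // sE.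
Qed.

Lemma alpha_bar_beta_barE (R : realType) (n : nat) (b : 'M[R]_n)
    (v l lam x : 'rV[R]_n) :
  \sum_(i < n) alpha_bar b v l lam i * x 0 i - beta_bar v lam =
  \sum_(i < n) lam 0 i *
    (offdiag_sum b i x + (v 0 i - l 0 i) * x 0 i - v 0 i).
Proof.
under [RHS]eq_bigr do rewrite mulrBr mulrDr mulrA.
rewrite sumrB big_split /=; congr (_ - _).
under eq_bigr do rewrite /alpha_bar mulrDl mulr_suml.
rewrite big_split /=; congr (_ + _).
(* The exchange regroups the column sums of [b] by rows; the guard then reads [i != j] instead of
   [j != i]. *)
rewrite (exchange_big_dep xpredT) //=; apply: eq_bigr => i _.
rewrite /offdiag_sum mulr_sumr; apply: eq_big => [j|j _].
  by rewrite eq_sym.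
by rewrite mulrA.
Qed.

Lemma PL2_PL2'_equivalent (R : realType) (n : nat) (b : 'M[R]_n)
    (c : 'rV[R]_n) (X : set 'rV[R]_n) (v l : 'rV[R]_n) :
  equivalent_problems (PL2 b c X v l) (PL2' b c X v l).
Proof.
pose f (s : 'rV[R]_n * 'rV[R]_n) :=
  (s.1, \row_i (s.2 0 i - l 0 i * s.1 0 i)).
pose g (s : 'rV[R]_n * 'rV[R]_n) :=
  (s.1, \row_i (s.2 0 i + l 0 i * s.1 0 i)).
apply: (@equivalent_of_maps _ (PL2 b c X v l) (PL2' b c X v l) f g).
- move=> [x y] /= [Xx xyP]; split.
    by split=> // i; rewrite mxE /=; have [? ?] := xyP i; split; lra.
  by apply: ler_sum => i _; rewrite mxE /=; lra.
- move=> [x t] /= [Xx xtP]; split.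
    by split=> // i; rewrite mxE /=; have [? ?] := xtP i; split; lra.
  by apply: ler_sum => i _; rewrite mxE /=; lra.
Qed.

Lemma PL2'_DL2_equivalent (R : realType) (n : nat) (b : 'M[R]_n)
    (c : 'rV[R]_n) (X : set 'rV[R]_n) (v l : 'rV[R]_n) :
  equivalent_problems (PL2' b c X v l) (DL2 b c X v l).
Proof.
pose w (x : 'rV[R]_n) i :=
  offdiag_sum b i x + (v 0 i - l 0 i) * x 0 i - v 0 i.
pose f (s : 'rV[R]_n * 'rV[R]_n) := (\sum_(i < n) s.2 0 i, s.1).
(* [g] forgets [z] and takes the least [t] feasible for the given [x]. *)
pose g (s : R * 'rV[R]_n) := (s.2, \row_i Num.max 0 (w s.2 i)).
apply: (@equivalent_of_maps _ (PL2' b c X v l) (DL2 b c X v l) f g).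
- move=> [x t] /= [Xx xtP]; split; last by rewrite big_split.
  split=> // lam lam01; rewrite alpha_bar_beta_barE; apply: ler_sum => i _.
  have [w_le t_ge0] := xtP i.
  (* The two values of [lam 0 i] call for the two constraints on [t 0 i]: nonnegativity for 0, the
     bound by [w x i] for 1. *)
  by case: (lam01 i) => ->; rewrite ?mul0r ?mul1r.
- move=> [z x] /= [Xx zxP]; split.
    by split=> // i; rewrite mxE /= !le_max !lexx orbT.
  rewrite big_split lerD2r /=.
  (* The tightest constraint at [x]: selecting the indices with [w x i] positive makes each term
     [lam 0 i * w x i] equal to the maximum of 0 and [w x i]. *)
  pose lam : 'rV[R]_n := \row_i (0 < w x i)%R%:R.
  have lam01 : binary_cube lam.
    by move=> i; rewrite mxE; case: ltP; [right|left].
  apply: le_trans (zxP _ lam01); rewrite alpha_bar_beta_barE.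
  apply: ler_sum => i _; rewrite !mxE -/(w x i) /=.
  by case: ltP; rewrite ?mul1r ?mul0r.
Qed.

Theorem theorem5 (R : realType) (n : nat) (n_ge1 : (1 <= n)%N)
    (b : 'M[R]_n) (b_ge0 : forall i j, 0 <= b i j)
    (b_diag : forall i, b i i = 0)
    (c : 'rV[R]_n) (X Xbar : set 'rV[R]_n)
    (X_binary : X `<=` @binary_cube R n)
    (X_sub_Xbar : X `<=` Xbar)
    (Xbar_sub_cube : Xbar `<=` @unit_cube R n)
    (v l : 'rV[R]_n)
    (v_max : forall i, is_max (offdiag_values b Xbar i 0) (v 0 i))
    (l_min : forall i, is_min (offdiag_values b Xbar i 1) (l 0 i)) :
  equivalent_problems (PL2 b c X v l) (DL2 b c X v l) /\
  equivalent_problems (PL2' b c X v l) (DL2 b c X v l).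
Proof.
split; last exact: PL2'_DL2_equivalent.
exact: equivalent_problems_trans (PL2_PL2'_equivalent _ _ _ _ _)
  (PL2'_DL2_equivalent _ _ _ _ _).
Qed.
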